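(* Let $\mathcal{H}_0, \mathcal{H}_1$ be Hilbert spaces, let $A \subseteq \mathcal{L}(\mathcal{H}_0)$ be a concrete C*-algebra, and let $\mathsf{X} \subseteq \mathcal{L}(\mathcal{H}_0, \mathcal{H}_1)$ be a closed subspace such that $xa \in \mathsf{X}$ for all $x \in \mathsf{X}$ and all $a\in A$, and such that $x^*y \in A$ for all $x,y \in \mathsf{X}$; regard $\mathsf{X}$ as a right Hilbert $A$-module with $\langle x,y\rangle_A=x^*y$. Suppose that $\mathsf{X}\mathcal{H}_0$ is dense in $\mathcal{H}_1$. Then there is a $*$-isomorphism from $\mathcal{K}_A(\mathsf{X})$ to $$\overline{\mathrm{span} \{ xy^* \colon x,y \in \mathsf{X} \}} \subseteq \mathcal{L}(\mathcal{H}_1)$$ which sends $\theta_{x,y}$ to $xy^*$ for $x,y \in \mathsf{X}$.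
   Context: $\mathcal{L}(\mathcal{H}_0,\mathcal{H}_1)$ is the space of bounded linear maps, and $\mathcal{L}(\mathcal{H})=\mathcal{L}(\mathcal{H},\mathcal{H})$. $\mathsf{X}\mathcal{H}_0=\mathrm{span}\{x\xi\colon x\in\mathsf{X},\ \xi\in\mathcal{H}_0\}\subseteq\mathcal{H}_1$. The right action of $A$ on $\mathsf{X}$ is composition of operators; with $\langle x,y\rangle_A=x^*y$, $\mathsf{X}$ is a right Hilbert $A$-module whose module norm equals the operator norm. For $x,y\in\mathsf{X}$, $\theta_{x,y}$ is the adjointable map on $\mathsf{X}$ given by $\theta_{x,y}(z)=x\langle y,z\rangle_A$, and $\mathcal{K}_A(\mathsf{X})=\overline{\mathrm{span}\{\theta_{x,y}\colon x,y\in\mathsf{X}\}}$, the closure being taken in the C*-algebra $\mathcal{L}_A(\mathsf{X})$ of adjointable maps $\mathsf{X}\to\mathsf{X}$. *)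

(* Defs.v *)
From HB Require Import structures.
From mathcomp Require Import all_boot all_order all_algebra.
From mathcomp Require Import sesquilinear complex.
From mathcomp Require Import boolp classical_sets functions reals topology.
From mathcomp Require Import normedtype ring lra.

Set Implicit Arguments.
Unset Strict Implicit.
Unset Printing Implicit Defensive.

Import Order.TTheory GRing.Theory Num.Theory.
Import numFieldNormedType.Exports.

Local Open Scope classical_set_scope.
Local Open Scope complex_scope.
Local Open Scope ring_scope.

Reserved Notation "{ 'blinear' V -> W }"
  (at level 0, V at level 98, W at level 99, format "{ 'blinear'  V  ->  W }").

Lemma real_complexD (R : realType) (a b : R) : (a + b)%:C = a%:C + b%:C.
Proof. exact: rmorphD. Qed.

Lemma real_complexM (R : realType) (a b : R) : (a * b)%:C = a%:C * b%:C.
Proof. exact: rmorphM. Qed.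

Section BoundedLinear.
Variables (R : realType) (V W : normedModType R[i]).

Definition bounded_linear (f : V -> W) : Prop :=
  linear f /\ exists M : R, forall x, `|f x| <= M%:C * `|x|.

Definition blinear_pred : {pred V -> W} := fun f => `[< bounded_linear f >].

Record blinear := BLinear {
  blinear_fun :> V -> W;
  blinear_funP : blinear_fun \in blinear_pred }.

HB.instance Definition _ := [isSub for blinear_fun].
HB.instance Definition _ := [Choice of blinear by <:].

Lemma blinear_submod_closed : submod_closed blinear_pred.
Proof.
split=> [|a f g /asboolP[lf [M Mf]] /asboolP[lg [N Ng]]]; apply/asboolP.
  split; first by move=> a u v; rewrite /= scaler0 addr0.
  by exists 0 => x; rewrite normr0 mul0r.
have fgE x : (a *: f + g) x = a *: f x + g x by [].
split=> [b u v|].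
  rewrite !fgE lf lg !scalerDr !scalerA (mulrC a b) -!addrA.
  by congr (_ + _); rewrite addrCA.
exists (complex.Re `|a| * M + N) => x; rewrite fgE.
rewrite (le_trans (ler_normD _ _))// normrZ.
rewrite real_complexD real_complexM RRe_real ?normr_real//.
by rewrite mulrDl lerD// -mulrA ler_wpM2l.
Qed.

HB.instance Definition _ :=
  GRing.isSubmodClosed.Build R[i] (V -> W) blinear_pred blinear_submod_closed.
HB.instance Definition _ := [SubChoice_isSubLmodule of blinear by <:].

Lemma blinearD (f g : blinear) x : (f + g) x = f x + g x. Proof. by []. Qed.
Lemma blinearZ a (f : blinear) x : (a *: f) x = a *: f x. Proof. by []. Qed.

Lemma blinear_linear (f : blinear) : linear f.
Proof. by case: f => f /= /asboolP[]. Qed.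

HB.instance Definition _ (f : blinear) :=
  GRing.isLinear.Build R[i] V W _ f (@blinear_linear f).

Lemma blinear_bounded (f : blinear) :
  exists M : R, forall x, `|f x| <= M%:C * `|x|.
Proof. by case: f => f /= /asboolP[]. Qed.

Lemma blinearP (f g : blinear) : f =1 g -> f = g.
Proof. by move=> fg; apply/val_inj/funext. Qed.

Let unit_image (f : blinear) : set R :=
  [set complex.Re `|f x| | x in [set x | `|x| <= 1]].

Definition opnorm (f : blinear) : R := sup (unit_image f).

Let Re_normE (U : normedModType R[i]) (x : U) : (complex.Re `|x|)%:C = `|x|.
Proof. by rewrite RRe_real ?normr_real. Qed.

Let unit_image_nonempty f : unit_image f !=set0.
Proof. by exists (complex.Re `|f 0|), 0 => //=; rewrite normr0 ler01. Qed.

Let unit_image_ub f : has_ubound (unit_image f).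
Proof.
have [M fM] := blinear_bounded f; exists `|M| => _ [x /= x1 <-].
rewrite -lecR Re_normE (le_trans (fM x))//.
have M0 : M%:C <= `|M|%:C by rewrite lecR ler_norm.
rewrite (le_trans (ler_wpM2r (normr_ge0 _) M0))// ler_piMr//.
by rewrite -[0]/(0%:C) lecR normr_ge0.
Qed.

Lemma opnorm_ge0 f : 0 <= opnorm f.
Proof.
apply: le_trans (ub_le_sup (unit_image_ub f) _); last first.
  by exists 0 => //=; rewrite normr0 ler01.
by rewrite -lecR Re_normE normr_ge0.
Qed.

Lemma opnorm_bound (f : blinear) x : `|f x| <= (opnorm f)%:C * `|x|.
Proof.
have [->|x0] := eqVneq x 0; first by rewrite linear0 !normr0 mulr0.
have nx : 0 < `|x| by rewrite normr_gt0.
have u1 : `| `|x|^-1 *: x| <= 1.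
  by rewrite normrZ ger0_norm ?invr_ge0// mulVf ?gt_eqF.
rewrite -ler_pdivrMr//.
have -> : `|f x| / `|x| = `|f (`|x|^-1 *: x)|.
  by rewrite linearZ/= normrZ ger0_norm ?invr_ge0// mulrC.
rewrite -[leLHS]Re_normE lecR; apply: (ub_le_sup (unit_image_ub f)).
by exists (`|x|^-1 *: x).
Qed.

Lemma opnorm_le (f : blinear) (M : R) : 0 <= M ->
  (forall x, `|f x| <= M%:C * `|x|) -> opnorm f <= M.
Proof.
move=> M0 fM; apply: ge_sup => // _ [x /= x1 <-].
by rewrite -lecR Re_normE (le_trans (fM x))// ler_piMr// -[0]/(0%:C) lecR.
Qed.

Let opnormD (f g : blinear) :
  (opnorm (f + g))%:C <= (opnorm f)%:C + (opnorm g)%:C.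
Proof.
rewrite -real_complexD lecR; apply: opnorm_le.
  by rewrite addr_ge0 ?opnorm_ge0.
move=> x; rewrite blinearD real_complexD mulrDl (le_trans (ler_normD _ _))//.
by rewrite lerD ?opnorm_bound.
Qed.

Let opnormZ_le a (f : blinear) : (opnorm (a *: f))%:C <= `|a| * (opnorm f)%:C.
Proof.
rewrite -[`|a|]RRe_real ?normr_real// -real_complexM lecR; apply: opnorm_le.
  by apply: mulr_ge0; rewrite ?opnorm_ge0// -lecR RRe_real ?normr_real//
    normr_ge0.
move=> x; rewrite blinearZ normrZ real_complexM RRe_real ?normr_real//.
by rewrite -mulrA ler_wpM2l// opnorm_bound.
Qed.

Let opnormZ a (f : blinear) : (opnorm (a *: f))%:C = `|a| * (opnorm f)%:C.
Proof.
apply/le_anti; rewrite opnormZ_le /=.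
have [->|a0] := eqVneq a 0.
  by rewrite normr0 mul0r -[0]/(0%:C) lecR opnorm_ge0.
rewrite -ler_pdivlMl ?normr_gt0// -normfV.
by rewrite -[X in (opnorm X)%:C](scalerK a0) opnormZ_le.
Qed.

Let opnorm0_eq0 (f : blinear) : (opnorm f)%:C = 0 -> f = 0.
Proof.
move=> f0; apply: blinearP => x; apply/eqP.
by rewrite -normr_le0 (le_trans (opnorm_bound f x))// f0 mul0r.
Qed.

HB.instance Definition _ := Lmodule_isNormed.Build R[i] blinear
  opnormD opnormZ opnorm0_eq0.

End BoundedLinear.
Notation "{ 'blinear' V -> W }" := (blinear V W) : type_scope.

Section Composition.
Variables (R : realType) (U V W : normedModType R[i]).

Lemma comp_blinear (g : {blinear V -> W}) (f : {blinear U -> V}) :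
  (g \o f) \in @blinear_pred R U W.
Proof.
apply/asboolP; split=> [a u v|]; first by rewrite /= !linearP.
exists (opnorm g * opnorm f) => x /=.
rewrite real_complexM (le_trans (opnorm_bound _ _))// -mulrA.
by rewrite ler_wpM2l ?opnorm_bound// -[0]/(0%:C) lecR opnorm_ge0.
Qed.

Definition bcomp (g : {blinear V -> W}) (f : {blinear U -> V}) :
  {blinear U -> W} := BLinear (comp_blinear g f).

Lemma bcompP a g f1 f2 : bcomp g (a *: f1 + f2) = a *: bcomp g f1 + bcomp g f2.
Proof.
by apply: blinearP => x; rewrite blinearD blinearZ /= -linearZ -linearD.
Qed.

Lemma bcomp_norm (g : {blinear V -> W}) (f : {blinear U -> V}) :
  `|bcomp g f| <= `|g| * `|f|.
Proof.
rewrite -[leRHS]real_complexM lecR; apply: opnorm_le.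
  by rewrite mulr_ge0 ?opnorm_ge0.
move=> x; rewrite real_complexM (le_trans (opnorm_bound g _))// -mulrA.
by rewrite ler_wpM2l ?opnorm_bound// -[0]/(0%:C) lecR opnorm_ge0.
Qed.

End Composition.

Notation "g \ob f" := (bcomp g f) 
  (at level 40, left associativity) : ring_scope.

(* The library's [dot] forms are linear in their first argument. *)
HB.mixin Record isHilbert (R : realType) H & CompleteNormedModule R[i] H := {
  inner : {dot H for Num.conj};
  inner_norm : forall u : H, inner u u = `|u| ^+ 2 }.

#[short(type="hilbertType")]
HB.structure Definition Hilbert (R : realType) :=
  {H of isHilbert R H & CompleteNormedModule R[i] H}.

(* [xget] returns the Hilbert-space adjoint, which exists by the Riesz
   representation theorem: see [adjP] below. *)
Definition adj (R : realType) (H0 H1 : hilbertType R)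
    (x : {blinear H0 -> H1}) : {blinear H1 -> H0} :=
  xget 0 [set y : {blinear H1 -> H0} |
    forall xi eta, inner (x xi) eta = inner xi (y eta)].

Section Riesz.
Variables (R : realType) (H : hilbertType R).
Implicit Types (u v h z : H) (t : R).

Let rip u v : R := complex.Re (inner u v).
Let nr u : R := complex.Re `|u|.

Let ReD (a b : R[i]) : complex.Re (a + b) = complex.Re a + complex.Re b.
Proof. by case: a b => [? ?] [? ?]. Qed.
Let ReZ t (a : R[i]) : complex.Re (t%:C * a) = t * complex.Re a.
Proof. by case: a => a b /=; rewrite mul0r subr0. Qed.

Let ripC u v : rip u v = rip v u.
Proof.
rewrite /rip (hermC inner) /= expr0 mul1r.
by case: (inner v u).
Qed.
Let ripDl u v w : rip (u + v) w = rip u w + rip v w.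
Proof. by rewrite /rip linearDl ReD. Qed.
Let ripZl t u v : rip (t%:C *: u) v = t * rip u v.
Proof. by rewrite /rip linearZl_LR /= ReZ. Qed.
Let ripDr u v w : rip w (u + v) = rip w u + rip w v.
Proof. by rewrite ripC ripDl ![rip _ w]ripC. Qed.
Let ripZr t u v : rip v (t%:C *: u) = t * rip v u.
Proof. by rewrite ripC ripZl ripC. Qed.

Let ripNl u v : rip (- u) v = - rip u v.
Proof.
have -> : - u = (-1)%:C *: u by rewrite rmorphN1 scaleN1r.
by rewrite ripZl mulN1r.
Qed.
Let ripNr u v : rip v (- u) = - rip v u.
Proof. by rewrite ripC ripNl ripC. Qed.

Let nrE u : (nr u)%:C = `|u|.
Proof. by rewrite RRe_real ?normr_real. Qed.
Let nr_ge0 u : 0 <= nr u.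
Proof. by rewrite -lecR nrE normr_ge0. Qed.
Let nr2 u : rip u u = nr u ^+ 2.
Proof. by rewrite /rip inner_norm -nrE -[in LHS]rmorphXn. Qed.

Let discr (a b c : R) : 0 <= a ->
  (forall t, 0 <= t ^+ 2 * a + 2 * t * b + c) -> b ^+ 2 <= a * c.
Proof.
move=> a0 abc; have [a_0|a_n0] := eqVneq a 0.
  rewrite a_0 mul0r; have [->|b0] := eqVneq b 0; first by rewrite expr0n.
  have := abc (- (c + 1) / (2 * b)); rewrite a_0 mulr0 add0r.
  have -> : 2 * (- (c + 1) / (2 * b)) * b + c = -1 by field.
  by rewrite oppr_ge0 ler10.
have a_gt0 : 0 < a by rewrite lt_def a_n0.
have := abc (- b / a).
have -> : (- b / a) ^+ 2 * a + 2 * (- b / a) * b + c = (a * c - b ^+ 2) / a.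
  by field.
by rewrite pmulr_lge0 ?invr_gt0// subr_ge0.
Qed.

Let CS u v : `|rip u v| <= nr u * nr v.
Proof.
rewrite -ler_sqr ?nnegrE ?mulr_ge0// real_normK ?num_real// exprMn -!nr2.
apply: discr; first by rewrite nr2 sqr_ge0.
move=> t; have := sqr_ge0 (nr (t%:C *: u + v)).
rewrite -nr2 ripDl !ripDr !ripZl !ripZr (ripC v u); lra.
Qed.

Lemma real_riesz (F : H -> R) (M : R) :
  (forall u v, F (u + v) = F u + F v) ->
  (forall t u, F (t%:C *: u) = t * F u) ->
  (forall u, F u <= M * nr u) ->
  exists z, forall h, F h = rip h z.
Proof.
move=> FD FZ FM.
pose Q u := rip u u - 2 * F u.
have Qlb : has_lbound (range Q).
  exists (- M ^+ 2) => _ [u _ <-]; rewrite /Q nr2.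
  have := FM u; have := sqr_ge0 (nr u - M); rewrite sqrrB; lra.
have Qinf : has_inf (range Q) by split => //; exists (Q 0), 0.
pose m := inf (range Q).
have mQ u : m <= Q u by apply: ge_inf => //; exists u.
pose D e := [set u | Q u <= m + e].
have D0 e : 0 < e -> D e !=set0.
  move=> e0; have [_ [u _ <-] /ltW Qu] := inf_adherent e0 Qinf.
  by exists u.
have Dparal e u v : D e u -> D e v -> nr (u - v) ^+ 2 <= 4 * e.
  move=> Du Dv; have := mQ ((2^-1)%:C *: (u + v)).
  move: Du Dv; rewrite /D /Q /= -nr2.
  rewrite FZ FD !(ripDl, ripDr, ripZl, ripZr, ripNl, ripNr) (ripC v u); lra.
have Dvar e u h : D e u -> (rip h u - F h) ^+ 2 <= nr h ^+ 2 * e.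
  move=> Du; apply: discr; first exact: sqr_ge0.
  move=> t; have := mQ (u + t%:C *: h); move: Du.
  rewrite /D /Q /= FD FZ !(ripDl, ripDr, ripZl, ripZr) -nr2 (ripC u h); lra.
pose FF := filter_from [set e : R | 0 < e] D.
have FFp : ProperFilter FF.
  apply: filter_from_proper => //; apply: filter_from_filter.
    by exists 1 => /=.
  move=> e1 e2 /= e10 e20; exists (Num.min e1 e2) => /=.
    by rewrite lt_min e10.
  move=> u; rewrite /D /= => Du; split; apply: (le_trans Du); rewrite lerD2l.
    by rewrite ge_min lexx.
  by rewrite ge_min lexx orbT.
have ltball (u v : H) (e : R) : 0 < e -> nr (u - v) < e -> ball u e%:C v.
  by move=> e0 ue; rewrite -ball_normE /= -nrE ltcR.
have FFc : cauchy FF.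
  apply/cauchyP => eps eps0.
  have epsE : eps = (complex.Re eps)%:C by rewrite RRe_real ?gtr0_real.
  pose r := complex.Re eps.
  have r0 : 0 < r by rewrite -ltcR -epsE.
  have e0 : 0 < r ^+ 2 / 8 by rewrite divr_gt0 ?exprn_gt0.
  have [u Du] := D0 _ e0; exists u; exists (r ^+ 2 / 8) => // v Dv.
  rewrite epsE; apply: ltball => //.
  rewrite -ltr_sqr ?nnegrE ?(ltW r0)// (le_lt_trans (Dparal _ _ _ Du Dv))//.
  have : 0 < r ^+ 2 by rewrite exprn_gt0.
  lra.
have /cvg_ex[z FFz] : cvg FF by exact: cauchy_cvg.
have near_z d : 0 < d -> exists2 u, D (d ^+ 2) u & nr (z - u) < d.
  move=> d0; have FFb : FF (ball z d%:C).
    by apply: FFz; apply: nbhsx_ballx; rewrite -[0]/(0%:C) ltcR.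
  have FFD : FF (D (d ^+ 2)) by exists (d ^+ 2) => //=; rewrite exprn_gt0.
  have [u [Bu Du]] := filter_ex (filterI FFb FFD).
  by exists u => //; rewrite -ltcR nrE; move: Bu; rewrite -ball_normE.
exists z => h; apply/eqP; rewrite eq_sym -subr_eq0 -normr_le0.
have bound d : 0 < d -> `|rip h z - F h| <= 2 * nr h * d.
  move=> d0; have [u Du zu] := near_z d d0.
  have -> : rip h z - F h = rip h (z - u) + (rip h u - F h).
    by rewrite ripDr ripNr; ring.
  rewrite (le_trans (ler_normD _ _))// mulrDl mul1r mulrDl lerD//.
    by rewrite (le_trans (CS _ _))// ler_wpM2l// ltW.
  rewrite -ler_sqr ?nnegrE ?mulr_ge0// ?(ltW d0)//.
  by rewrite real_normK ?num_real// exprMn Dvar.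
apply/ler_addgt0Pl => e e0; rewrite addr0.
have k0 : 0 < 2 * nr h + 1 by have := nr_ge0 h; lra.
rewrite (le_trans (bound (e / (2 * nr h + 1)) _)) ?divr_gt0//.
rewrite mulrCA ger_pMr// ler_pdivrMr// mul1r; lra.
Qed.

Lemma riesz (f : H -> R[i]) (M : R) :
  (forall u v, f (u + v) = f u + f v) -> (forall a u, f (a *: u) = a * f u) ->
  (forall u, complex.Re (f u) <= M * complex.Re `|u|) ->
  exists z, forall h, f h = inner h z.
Proof.
move=> fD fZ fM.
have [||//|z fz] := @real_riesz (fun h => complex.Re (f h)) M.
- by move=> u v; rewrite fD ReD.
- by move=> t u; rewrite fZ ReZ.
exists z => h; have := fz ('i *: h); have := fz h.
rewrite /rip fZ linearZl_LR /=.
case: (f h) (inner h z) => [a b] [c d] /= -> /eqP.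
by rewrite !mul0r !mul1r !sub0r eqr_opp => /eqP ->.
Qed.

Lemma inner_eqP u v : (forall h, inner h u = inner h v) -> u = v.
Proof.
move=> uv; apply/eqP; rewrite -subr_eq0 -(dnorm_eq0 inner).
by rewrite linearB /= uv subrr.
Qed.

Lemma Re_inner_le u v :
  complex.Re (inner u v) <= complex.Re `|u| * complex.Re `|v|.
Proof. exact: le_trans (ler_norm _) (CS u v). Qed.

Lemma inner_self_norm u : complex.Re (inner u u) = complex.Re `|u| ^+ 2.
Proof. exact: nr2. Qed.

End Riesz.

Section Adjoint.
Variables (R : realType) (H0 H1 : hilbertType R) (x : {blinear H0 -> H1}).

Let nr (H : hilbertType R) (u : H) : R := complex.Re `|u|.
Let nrE (H : hilbertType R) (u : H) : (nr u)%:C = `|u|.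
Proof. by rewrite RRe_real ?normr_real. Qed.
Let nr_ge0 (H : hilbertType R) (u : H) : 0 <= nr u.
Proof. by rewrite -lecR nrE normr_ge0. Qed.
Let xM u : nr (x u) <= opnorm x * nr u.
Proof. by rewrite -lecR real_complexM !nrE opnorm_bound. Qed.

Lemma adj_exists : exists y : {blinear H1 -> H0},
  forall xi eta, inner (x xi) eta = inner xi (y eta).
Proof.
have /choice[y yP] : forall eta, exists z, forall xi,
    inner (x xi) eta = inner xi z.
  move=> eta; apply: (@riesz _ _ _ (opnorm x * nr eta)).
  - by move=> u v; rewrite linearD linearDl.
  - by move=> a u; rewrite linearZ /= linearZl_LR.
  - move=> u; rewrite (le_trans (Re_inner_le _ _))// mulrAC.
    by apply: ler_wpM2r; [exact: nr_ge0|exact: xM].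
have ybl : y \in @blinear_pred R H1 H0.
  apply/asboolP; split=> [a u v|].
    apply: inner_eqP => xi.
    by rewrite -yP linearDr [RHS]linearDr !linearZr_LR /= !yP.
  exists (opnorm x) => eta; rewrite -!nrE -real_complexM lecR.
  have [->|y0] := eqVneq (nr (y eta)) 0.
    by rewrite mulr_ge0 ?opnorm_ge0 ?nr_ge0.
  have ygt0 : 0 < nr (y eta) by rewrite lt_def y0 nr_ge0.
  rewrite -(ler_pM2l ygt0) -expr2 -[leLHS]inner_self_norm -yP.
  rewrite (le_trans (Re_inner_le _ _))// mulrA (mulrC (nr (y eta))).
  by apply: ler_wpM2r; [exact: nr_ge0|exact: xM].
by exists (BLinear ybl).
Qed.

Lemma adjP xi eta : inner (x xi) eta = inner xi (adj x eta).
Proof.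
rewrite /adj; case: xgetP => [y _ -> //|no].
by have [y yP] := adj_exists; case: (no y).
Qed.

End Adjoint.

Section AdjointTheory.
Variables (R : realType) (H0 H1 : hilbertType R).
Implicit Types x y : {blinear H0 -> H1}.

Let nr (H : hilbertType R) (u : H) : R := complex.Re `|u|.
Let nrE (H : hilbertType R) (u : H) : (nr u)%:C = `|u|.
Proof. by rewrite RRe_real ?normr_real. Qed.
Let nr_ge0 (H : hilbertType R) (u : H) : 0 <= nr u.
Proof. by rewrite -lecR nrE normr_ge0. Qed.

Lemma opnorm_adj_le x : opnorm (adj x) <= opnorm x.
Proof.
apply: opnorm_le => [|eta]; first exact: opnorm_ge0.
rewrite -!nrE -real_complexM lecR.
have [->|y0] := eqVneq (nr (adj x eta)) 0.
  by rewrite mulr_ge0 ?opnorm_ge0 ?nr_ge0.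
have ygt0 : 0 < nr (adj x eta) by rewrite lt_def y0 nr_ge0.
rewrite -(ler_pM2l ygt0) -expr2 -[leLHS]inner_self_norm -adjP.
rewrite (le_trans (Re_inner_le _ _))// mulrA (mulrC (nr (adj x eta))).
apply: ler_wpM2r; first exact: nr_ge0.
by rewrite -lecR real_complexM !nrE opnorm_bound.
Qed.

Lemma opnorm_sqr_le x : opnorm x ^+ 2 <= opnorm (adj x \ob x).
Proof.
have s0 := opnorm_ge0 (adj x \ob x).
rewrite -(sqr_sqrtr s0) ler_sqr ?nnegrE ?opnorm_ge0 ?sqrtr_ge0//.
apply: opnorm_le => [|xi]; first exact: sqrtr_ge0.
rewrite -!nrE -real_complexM lecR.
rewrite -ler_sqr ?nnegrE ?nr_ge0 ?mulr_ge0 ?sqrtr_ge0 ?nr_ge0//.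
rewrite exprMn sqr_sqrtr// -[leLHS]inner_self_norm adjP.
rewrite (le_trans (Re_inner_le _ _))// expr2 mulrA mulrC.
apply: ler_wpM2r; first exact: nr_ge0.
by rewrite -lecR real_complexM !nrE; exact: opnorm_bound.
Qed.

Lemma adj_semilinear a x y : adj (a *: x + y) = Num.conj a *: adj x + adj y.
Proof.
apply: blinearP => eta; apply: inner_eqP => xi.
rewrite -adjP blinearD blinearZ linearDl linearZl_LR /= !adjP.
by rewrite linearDr linearZr_LR /= conjCK.
Qed.

End AdjointTheory.

Definition lspan (K : pzRingType) (V : lmodType K) (S : set V) : set V :=
  [set v | exists n (a : 'I_n -> K) (s : 'I_n -> V),
     (forall i, S (s i)) /\ v = \sum_(i < n) a i *: s i].

Definition linear_subspace (K : pzRingType) (V : lmodType K) (S : set V) :=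
  S 0 /\ forall a u v, S u -> S v -> S (a *: u + v).

(* A norm-closed *-subalgebra; neither unital nor nondegenerate in general. *)
Record concreteCStar (R : realType) (H : hilbertType R) := ConcreteCStar {
  cstar_set :> set {blinear H -> H};
  cstar_subspace : linear_subspace cstar_set;
  cstar_mul : forall a b, cstar_set a -> cstar_set b -> cstar_set (a \ob b);
  cstar_adj : forall a, cstar_set a -> cstar_set (adj a);
  cstar_closed : closed cstar_set }.

(* The closed subspaces X of L(H0, H1) with X A in X and X^* X in A. *)
Record opModule (R : realType) (H0 H1 : hilbertType R)
    (A : concreteCStar H0) := OpModule {
  opmod_set : set {blinear H0 -> H1};
  opmod_subspace : linear_subspace opmod_set;
  opmod_closed : closed opmod_set;
  opmod_right : forall x a,
    opmod_set x -> cstar_set A a -> opmod_set (x \ob a);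
  opmod_inner : forall x y,
    opmod_set x -> opmod_set y -> cstar_set A (adj x \ob y) }.

Section OpModuleType.
Variables (R : realType) (H0 H1 : hilbertType R) (A : concreteCStar H0).
Variable X : opModule H1 A.

Definition opmod_pred : {pred {blinear H0 -> H1}} :=
  fun x => x \in opmod_set X.

Record opmod_elt := OpModElt {
  opmod_val :> {blinear H0 -> H1};
  opmod_valP : opmod_val \in opmod_pred }.

HB.instance Definition _ := [isSub for opmod_val].
HB.instance Definition _ := [Choice of opmod_elt by <:].

Lemma opmod_submod_closed : submod_closed opmod_pred.
Proof.
have [X0 XD] := opmod_subspace X.
split=> [|a u v /set_mem Xu /set_mem Xv]; apply/mem_set => //.
exact: XD.
Qed.

HB.instance Definition _ := GRing.isSubmodClosed.Build R[i]
  {blinear H0 -> H1} opmod_pred opmod_submod_closed.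
HB.instance Definition _ := [SubChoice_isSubLmodule of opmod_elt by <:].

Let opmod_norm (x : opmod_elt) : R[i] := `|opmod_val x|.

Let opmod_normD x y : opmod_norm (x + y) <= opmod_norm x + opmod_norm y.
Proof. exact: ler_normD. Qed.

Let opmod_normZ a x : opmod_norm (a *: x) = `|a| * opmod_norm x.
Proof. exact: normrZ. Qed.

Let opmod_norm0_eq0 x : opmod_norm x = 0 -> x = 0.
Proof. by move=> x0; apply/val_inj/normr0_eq0. Qed.

HB.instance Definition _ := Lmodule_isNormed.Build R[i] opmod_elt
  opmod_normD opmod_normZ opmod_norm0_eq0.

End OpModuleType.
Coercion opmod_elt : opModule >-> Sortclass.

Section HilbertModule.
Variables (R : realType) (H0 H1 : hilbertType R) (A : concreteCStar H0).
Variable X : opModule H1 A.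
Implicit Types (x y z : X) (a : A).

Lemma ract_subproof x a :
  opmod_val x \ob val a \in opmod_pred X.
Proof.
apply/mem_set/opmod_right; first exact: set_mem (valP x).
exact: set_mem (valP a).
Qed.

Definition ract x a : X := OpModElt (ract_subproof x a).

Lemma ainner_subproof x y : adj (opmod_val x) \ob opmod_val y \in cstar_set A.
Proof. by apply/mem_set/(opmod_inner (o := X)); exact: set_mem (valP _). Qed.

Definition ainner x y : A :=
  exist (fun b => b \in cstar_set A) _ (ainner_subproof x y).

Lemma theta_subproof x y :
  (fun z => ract x (ainner y z)) \in @blinear_pred R X X.
Proof.
apply/asboolP; split=> [c u v|].
  by apply: val_inj; rewrite /= !bcompP.
exists (complex.Re (`|x| * `|adj (opmod_val y)|)) => z.
rewrite RRe_real ?ger0_real ?mulr_ge0// -mulrA.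
rewrite (le_trans (bcomp_norm _ _))// ler_wpM2l//.
exact: bcomp_norm.
Qed.

Definition theta x y : {blinear X -> X} := BLinear (theta_subproof x y).

Definition is_adjoint (T S : X -> X) : Prop :=
  forall x y, ainner (T x) y = ainner x (S y).

(* Requiring T to be bounded and linear loses nothing: linearity is immediate
   from [ainner_eqP] and boundedness follows by the uniform boundedness
   principle. *)
Definition adjointable : set {blinear X -> X} :=
  [set T | exists S : X -> X, is_adjoint T S].

Definition madj (T : {blinear X -> X}) : {blinear X -> X} :=
  xget 0 [set S : {blinear X -> X} | is_adjoint T S].

Lemma ainner_eqP x y : (forall z, ainner z x = ainner z y) -> x = y.
Proof.
move=> /(_ (x - y))/(congr1 val) /= xy.
apply/eqP; rewrite -subr_eq0; apply/eqP; apply: val_inj => /=.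
set w := opmod_val x - opmod_val y.
have ww0 : adj w \ob w = 0.
  apply/eqP; have /eqP := xy; rewrite -subr_eq0 => /eqP <-; apply/eqP.
  by apply: blinearP => xi; rewrite blinearD /= linearB.
have := opnorm_sqr_le w; rewrite ww0.
have -> : opnorm (0 : {blinear H0 -> H0}) = 0.
  by have := normr0 {blinear H0 -> H0} => /(congr1 (@complex.Re R)).
rewrite le_eqVlt ltNge sqr_ge0 orbF sqrf_eq0 => /eqP w0.
by apply: normr0_eq0; rewrite /Num.norm /= w0.
Qed.

Lemma madjP T : adjointable T -> is_adjoint T (madj T).
Proof.
move=> [S TS]; suff Sbl : S \in @blinear_pred R X X.
  by rewrite /madj; case: xgetP => [S' _ //|/(_ (BLinear Sbl))/(_ TS)].
apply/asboolP; split=> [a u v|].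
  apply: ainner_eqP => z; rewrite -TS; apply: val_inj => /=.
  have vE w : adj (opmod_val z) \ob opmod_val (S w) =
              adj (opmod_val (T z)) \ob opmod_val w.
    by have /(congr1 val) := TS z w.
  by rewrite !bcompP !vE.
exists (opnorm T) => y.
have nX (z : X) : `|z| = (opnorm (opmod_val z))%:C by [].
have Tb z : opnorm (opmod_val (T z)) <= opnorm T * opnorm (opmod_val z).
  by rewrite -lecR real_complexM; exact: (opnorm_bound T z).
rewrite !nX -real_complexM lecR; set s := opnorm (opmod_val (S y)).
have [->|s0] := eqVneq s 0; first by rewrite mulr_ge0 ?opnorm_ge0.
have sgt0 : 0 < s by rewrite lt_def s0 opnorm_ge0.
rewrite -(ler_pM2l sgt0) -expr2 (le_trans (opnorm_sqr_le _))//.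
have /(congr1 val) /= <- := TS (S y) y.
have := bcomp_norm (adj (opmod_val (T (S y)))) (opmod_val y).
rewrite -[leRHS]real_complexM lecR => /le_trans; apply.
rewrite mulrA; apply: ler_wpM2r; first exact: opnorm_ge0.
by rewrite (le_trans (opnorm_adj_le _))// mulrC.
Qed.

(* The closure is the one in L_A(X), i.e. relative to the adjointable maps,
   for the operator norm of maps on X. *)
Definition compacts : set {blinear X -> X} :=
  adjointable `&`
  closure (lspan [set theta x y | x in [set: X] & y in [set: X]]).

End HilbertModule.

(* The algebras are subsets B and C of ambient spaces, so only the values of
   phi on B matter; mulU, starU, mulV and starV are the ambient operations. *)
Definition star_isomorphism (K : pzRingType) (U V : lmodType K)
    (mulU : U -> U -> U) (starU : U -> U) (mulV : V -> V -> V) (starV : V -> V)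
    (B : set U) (C : set V) (phi : U -> V) : Prop :=
  [/\ set_bij B C phi,
      forall a, {in B &, forall S T, phi (a *: S + T) = a *: phi S + phi T},
      {in B &, forall S T, phi (mulU S T) = mulV (phi S) (phi T)} &
      {in B, forall T, phi (starU T) = starV (phi T)}].

Arguments bcomp {R U V W} g f.
Arguments adj {R H0 H1} x.
Arguments madj {R H0 H1 A X} T.
Arguments adjointable {R H0 H1 A} X.
Arguments compacts {R H0 H1 A} X.

(* Main.v *)
Require Import Defs.
From mathcomp Require Import all_boot all_order all_algebra.
From mathcomp Require Import boolp classical_sets functions reals topology.
From mathcomp Require Import normedtype.
From mathcomp Require Import sesquilinear complex sequences ring.
Local Open Scope classical_set_scope.
Local Open Scope ring_scope.

(** An operator S on H1 implements a map T of X when T x = S x (composition of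
    operators) for every x in X; for instance x y^* implements theta_{x,y}.
    Since X H0 is dense, S is determined by T ([implements_unique]), and T is
    obviously determined by S.  The correspondence respects linear
    combinations, products and adjoints, and the isomorphism phi sends T to the
    operator implementing it.  What has to be shown is that this correspondence
    is defined on K_A(X), is isometric, and matches the two closures.

    Every adjointable T is implemented ([adjointable_implemented]).  The
    operator must send the vector sum_i x_i xi_i to sum_i (T x_i) xi_i, so the
    heart of the matter is the inequality ([ev_le])
      || sum_i (T x_i) xi_i || <= ||T|| || sum_i x_i xi_i ||.
    Instead of using positivity of ||T||^2 - T^*T in the C*-algebra of
    adjointable maps, put P = T^*T and v_n = sum_i (P^n x_i) xi_i.  Because P is
    self-adjoint, ||v_n||^2 = <v_0, v_2n> <= ||v_0|| ||v_2n||, and because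
    ||P|| <= ||T||^2, also ||v_n|| <= C ||T||^(2n) with a constant C that
    depends on the x_i and xi_i.  Repeated squaring makes C disappear and gives
    ||v_1|| <= ||T||^2 ||v_0|| ([le_of_doubling]); the claim follows from
    || sum_i (T x_i) xi_i ||^2 = <v_0, v_1>.  A bounded linear relation with
    dense domain extends to an operator with the same bound
    ([extend_dense_graph]), so the implementing operator exists, with norm at
    most that of T.

    The opposite inequality ||T|| <= ||S|| holds because the norm of X is the
    operator norm.  Hence approximating T by combinations of the theta_{x,y}
    is the same as approximating S by the corresponding combinations of the
    x y^*.  Conversely every S in the closed span of the x y^* maps X into X,
    since X X^* X is contained in X A and X is closed, and so does S^*; thus S
    implements an adjointable map. *)

Set Implicit Arguments.
Unset Strict Implicit.
Unset Printing Implicit Defensive.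

Import Order.TTheory GRing.Theory Num.Theory.
Import numFieldNormedType.Exports.
Local Open Scope complex_scope.

(** * A doubling inequality *)

(** The repeated squaring behind the spectral radius formula: at n = 2^k the
    hypotheses give (c_1/c_0)^n <= (C/c_0) r^n, and taking n-th roots the
    constant disappears in the limit. *)
Lemma le_of_doubling (R : realType) (c : nat -> R) (C r : R) :
  (forall n, 0 <= c n) -> (forall n, c n ^+ 2 <= c n.*2 * c 0%N) ->
  0 <= r -> (forall n, c n <= C * r ^+ n) -> c 1%N <= r * c 0%N.
Proof.
move=> c_ge0 c_dbl r0 c_le.
have [c00|c0_neq0] := eqVneq (c 0%N) 0.
  have := c_dbl 1%N; rewrite c00 !mulr0 le_eqVlt ltNge sqr_ge0 orbF.
  by rewrite sqrf_eq0 => /eqP->.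
have c0_gt0 : 0 < c 0%N by rewrite lt_def c0_neq0 c_ge0.
have c_pow k : c 1%N ^+ (2 ^ k) * c 0%N <= c (2 ^ k)%N * c 0%N ^+ (2 ^ k).
  elim: k => [|k IH]; first by rewrite !expr1.
  rewrite -(ler_pM2r c0_gt0) expnSr !exprM -mulrA -expr2 -exprMn.
  apply: (@le_trans _ _ ((c (2 ^ k)%N * c 0%N ^+ (2 ^ k)) ^+ 2)).
    by rewrite ler_sqr ?nnegrE ?mulr_ge0 ?exprn_ge0 ?c_ge0.
  rewrite exprMn [leRHS]mulrAC ler_wpM2r ?exprn_ge0 ?c_ge0//.
  by rewrite muln2.
rewrite leNgt; apply/negP => r_lt.
have c1_gt0 : 0 < c 1%N by rewrite (le_lt_trans _ r_lt) ?mulr_ge0 ?c_ge0.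
pose t := r * c 0%N / c 1%N.
have t0 : 0 <= t by rewrite divr_ge0 ?mulr_ge0 ?c_ge0.
have t1 : t < 1 by rewrite ltr_pdivrMr ?mul1r.
have C0 : 0 <= C by have := c_le 0%N; rewrite mulr1; apply: le_trans.
(* Along the powers of two c_0 <= C t^(2^k); as t <= 1 the other exponents
   follow, and the right-hand side tends to 0. *)
have c0_le k : c 0%N <= C * t ^+ k.
  apply: (@le_trans _ _ (C * t ^+ (2 ^ k))); last first.
    by rewrite ler_wpM2l// ler_wiXn2l ?(ltW t1)// ltnW// ltn_expl.
  rewrite expr_div_n mulrA ler_pdivlMr ?exprn_gt0// mulrC.
  rewrite (le_trans (c_pow k))// exprMn mulrA ler_wpM2r ?exprn_ge0 ?c_ge0//.
have : 0 >= c 0%N.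
  have tC : geometric C t @ \oo --> (0 : R).
    by apply: cvg_geometric; rewrite ger0_norm.
  rewrite -(cvg_lim _ tC)//; apply: limr_ge; first by apply/cvg_ex; exists 0.
  by apply: nearW => k; exact: c0_le.
by rewrite leNgt c0_gt0.
Qed.

(** * Real-valued norms *)

Section RealNorm.
Variables (R : realType) (V : normedModType R[i]).
Implicit Types u v : V.

(** The norm of a space over R[i] takes its values in R[i], which is only
    partially ordered; estimates are easier in R. *)
Definition rnorm u : R := complex.Re `|u|.

Lemma rnormE u : (rnorm u)%:C = `|u|.
Proof. by rewrite RRe_real ?normr_real. Qed.

Lemma rnorm_ge0 u : 0 <= rnorm u.
Proof. by rewrite -lecR rnormE normr_ge0. Qed.

Lemma rnormD u v : rnorm (u + v) <= rnorm u + rnorm v.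
Proof. by rewrite -lecR real_complexD !rnormE ler_normD. Qed.

Lemma rnormB u v : rnorm (u - v) = rnorm (v - u).
Proof. by rewrite /rnorm distrC. Qed.

Lemma rnorm_eq0 u : rnorm u <= 0 -> u = 0.
Proof. by rewrite -lecR rnormE normr_le0 => /eqP. Qed.

Lemma closure_rnormP (S : set V) u :
  closure S u <-> forall e : R, 0 < e -> exists2 v, S v & rnorm (u - v) < e.
Proof.
split=> [Su e e0|Su B /nbhs_ballP[e /= e0 eB]].
  have [|v [Sv uv]] := Su (ball u e%:C).
    by apply: nbhsx_ballx; rewrite -[0]/(0%:C) ltcR.
  by exists v => //; rewrite -ltcR rnormE; move: uv; rewrite -ball_normE.
have eE : e = (complex.Re e)%:C by rewrite RRe_real ?gtr0_real.
have [|v Sv uv] := Su (complex.Re e); first by rewrite -ltcR -eE.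
exists v; split => //; apply: eB.
by rewrite -ball_normE /= eE -rnormE ltcR.
Qed.

End RealNorm.

Lemma rnorm_blinear (R : realType) (V W : normedModType R[i])
  (f : {blinear V -> W}) u : rnorm (f u) <= opnorm f * rnorm u.
Proof. by rewrite -lecR real_complexM !rnormE opnorm_bound. Qed.

Lemma opnorm_bcomp (R : realType) (U V W : normedModType R[i])
  (g : {blinear V -> W}) (f : {blinear U -> V}) :
  opnorm (g \ob f) <= opnorm g * opnorm f.
Proof. by rewrite -lecR real_complexM; exact: bcomp_norm. Qed.

(** * Extension of densely defined bounded operators *)

Section Extension.
Variables (R : realType) (V : normedModType R[i])
  (W : completeNormedModType R[i]).
(* The operator is given by a relation, its graph, because the vectors on which
   it is known have many representations and well-definedness is a
   consequence of the bound. *)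
Variables (G : V -> W -> Prop) (M : R).
Hypothesis M_ge0 : 0 <= M.
Hypothesis G_linear : forall (a : R[i]) v w v' w',
  G v w -> G v' w' -> G (a *: v + v') (a *: w + w').
Hypothesis G_bounded : forall v w, G v w -> rnorm w <= M * rnorm v.
Hypothesis G_dense :
  forall v e, 0 < e -> exists v' w', G v' w' /\ rnorm (v - v') < e.

Let Gbar v w := forall e, 0 < e ->
  exists v' w', [/\ G v' w', rnorm (v - v') < e & rnorm (w - w') < e].

(** The values taken by the operator near v form a Cauchy filter, whose limit
    is the value at v. *)
Lemma ex_closure_graph v : exists w, Gbar v w.
Proof.
pose D e := [set w' | exists2 v', G v' w' & rnorm (v - v') < e].
pose FF := filter_from [set e : R | 0 < e] D.
have FFp : ProperFilter FF.
  apply: filter_from_proper => [|e e0]; last first.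
    by have [v' [w' [Gvw vv']]] := G_dense v e0; exists w', v'.
  apply: filter_from_filter; first by exists 1 => /=.
  move=> e1 e2 /= e10 e20; exists (Num.min e1 e2) => /=.
    by rewrite lt_min e10.
  by move=> w' [v' Gvw]; rewrite lt_min => /andP[? ?]; split; exists v'.
have FFc : cauchy FF.
  apply/cauchyP => eps eps0.
  have epsE : eps = (complex.Re eps)%:C by rewrite RRe_real ?gtr0_real.
  set r := complex.Re eps in epsE.
  have r0 : 0 < r by rewrite -ltcR -epsE.
  have M1 : 0 < M + 1 by rewrite ltr_wpDl.
  pose d := r / (2 * (M + 1)).
  have d0 : 0 < d by rewrite divr_gt0 ?mulr_gt0.
  have [v1 [w1 [G1 vv1]]] := G_dense v d0.
  exists w1; exists d => // w2 [v2 G2 vv2].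
  rewrite -ball_normE /= -rnormE epsE ltcR.
  have := G_linear (-1) G2 G1; rewrite !scaleN1r ![- _ + _]addrC => /G_bounded.
  move=> /le_lt_trans; apply.
  have v12 : rnorm (v1 - v2) < 2 * d.
    rewrite -(subrKA v) (le_lt_trans (rnormD _ _))// mulrDl mul1r.
    by rewrite ltrD// rnormB.
  have -> : r = (M + 1) * (2 * d).
    rewrite /d; field; exact: lt0r_neq0.
  apply: (@le_lt_trans _ _ ((M + 1) * rnorm (v1 - v2))).
    by rewrite ler_wpM2r ?rnorm_ge0// lerDl.
  by rewrite ltr_pM2l.
have /cvg_ex[w FFw] : cvg FF by exact: cauchy_cvg.
exists w => e e0.
have FFb : FF (ball w e%:C).
  by apply: FFw; apply: nbhsx_ballx; rewrite -[0]/(0%:C) ltcR.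
have FFD : FF (D e) by exists e.
have [w' [Bw' [v' Gvw' vv']]] := filter_ex (filterI FFb FFD).
exists v', w'; split => //.
by rewrite -ltcR rnormE; move: Bw'; rewrite -ball_normE.
Qed.

Lemma closure_graph_linear (a : R[i]) v w v' w' :
  Gbar v w -> Gbar v' w' -> Gbar (a *: v + v') (a *: w + w').
Proof.
move=> Gvw Gvw' e e0.
pose k := rnorm (a : R[i]^o) + 1.
have k0 : 0 < k by rewrite ltr_wpDl// rnorm_ge0.
have d0 : 0 < e / (2 * k) by rewrite divr_gt0 ?mulr_gt0.
have [v1 [w1 [G1 vv1 ww1]]] := Gvw _ d0.
have e2 : 0 < e / 2 by rewrite divr_gt0.
have [v2 [w2 [G2 vv2 ww2]]] := Gvw' _ e2.
have key (U : normedModType R[i]) (x x1 x' x2 : U) :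
    rnorm (x - x1) < e / (2 * k) -> rnorm (x' - x2) < e / 2 ->
    rnorm (a *: x + x' - (a *: x1 + x2)) < e.
  move=> xx1 xx2; rewrite opprD addrACA -scalerBr.
  rewrite (le_lt_trans (rnormD _ _))// [ltRHS]splitr ltr_leD//; last exact: ltW.
  apply: (@le_lt_trans _ _ (k * rnorm (x - x1))).
    rewrite -lecR real_complexM !rnormE normrZ ler_wpM2r// real_complexD rnormE.
    by rewrite lerDl -[0]/(0%:C) lecR.
  by rewrite mulrC -ltr_pdivlMr// -mulrA -invfM.
by exists (a *: v1 + v2), (a *: w1 + w2); split; [exact: G_linear|exact: key..].
Qed.

Lemma closure_graph_bounded v w : Gbar v w -> rnorm w <= M * rnorm v.
Proof.
move=> Gvw; apply/ler_addgt0Pl => e e0.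
have k0 : 0 < M + 1 by rewrite ltr_wpDl.
have d0 : 0 < e / (M + 1) by rewrite divr_gt0.
have [v1 [w1 [G1 vv1 ww1]]] := Gvw _ d0.
have w_le : rnorm w <= e / (M + 1) + rnorm w1.
  rewrite -[in leLHS](subrK w1 w) (le_trans (rnormD _ _))// lerD2r; exact: ltW.
have v1_le : rnorm v1 <= e / (M + 1) + rnorm v.
  rewrite -[in leLHS](subrK v v1) (le_trans (rnormD _ _))// lerD2r rnormB.
  exact: ltW.
apply: (le_trans w_le).
have := le_trans (G_bounded G1) (ler_wpM2l M_ge0 v1_le).
rewrite mulrDr -(lerD2l (e / (M + 1))) => /le_trans; apply.
rewrite le_eqVlt; apply/orP; left; apply/eqP; field; exact: lt0r_neq0.
Qed.

Lemma extend_dense_graph :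
  exists2 S : {blinear V -> W},
    forall v w, G v w -> S v = w & opnorm S <= M.
Proof.
have [S GS] := choice ex_closure_graph.
have Gbar_fun v w w' : Gbar v w -> Gbar v w' -> w = w'.
  move=> Gw Gw'; have := closure_graph_linear (-1) Gw Gw'.
  rewrite !scaleN1r addNr addrC => /closure_graph_bounded.
  have -> : rnorm (0 : V) = 0 by rewrite /rnorm normr0.
  by rewrite mulr0 => /rnorm_eq0/eqP; rewrite subr_eq0 => /eqP.
have Sbl : S \in @blinear_pred R V W.
  apply/asboolP; split=> [a u v|].
    by apply: Gbar_fun (GS _) _; exact: closure_graph_linear.
  exists M => v; rewrite -!rnormE -real_complexM lecR.
  exact: closure_graph_bounded.
exists (BLinear Sbl) => [v w Gvw|]; last first.
  apply: opnorm_le => // v; rewrite -!rnormE -real_complexM lecR.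
  exact: closure_graph_bounded.
apply: Gbar_fun (GS v) _ => e e0; exists v, w; split=> //;
  by rewrite subrr /rnorm normr0.
Qed.

End Extension.

(** * Adjoints, compositions and spans *)

Section HilbertAdjoint.
Variable R : realType.

Lemma innerC (H : hilbertType R) (u v : H) :
  inner u v = Num.conj (inner v u).
Proof. by rewrite (hermC inner) /= expr0 mul1r. Qed.

Lemma adjP_sym (H0 H1 : hilbertType R) (x : {blinear H0 -> H1}) xi eta :
  inner (adj x eta) xi = inner eta (x xi).
Proof. by rewrite innerC -adjP -innerC. Qed.

Lemma adj_unique (H0 H1 : hilbertType R) (x : {blinear H0 -> H1})
    (y : {blinear H1 -> H0}) :
  (forall xi eta, inner (x xi) eta = inner xi (y eta)) -> adj x = y.
Proof.
by move=> xy; apply: blinearP => eta; apply: inner_eqP => xi; rewrite -adjP.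
Qed.

Lemma adjK (H0 H1 : hilbertType R) (x : {blinear H0 -> H1}) :
  adj (adj x) = x.
Proof. by apply: adj_unique => xi eta; rewrite adjP_sym. Qed.

Lemma adj_bcomp (H0 H1 H2 : hilbertType R) (x : {blinear H1 -> H2})
    (y : {blinear H0 -> H1}) : adj (x \ob y) = adj y \ob adj x.
Proof. by apply: adj_unique => xi eta; rewrite /= !adjP. Qed.

Lemma adjB (H0 H1 : hilbertType R) (x y : {blinear H0 -> H1}) :
  adj (x - y) = adj x - adj y.
Proof.
have := adj_semilinear (-1) y x.
by rewrite scaleN1r rmorphN1 scaleN1r ![- _ + _]addrC.
Qed.

End HilbertAdjoint.

Lemma bcompA (R : realType) (V0 V1 V2 V3 : normedModType R[i])
    (f : {blinear V2 -> V3}) (g : {blinear V1 -> V2}) (h : {blinear V0 -> V1}) :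
  f \ob g \ob h = f \ob (g \ob h).
Proof. exact: blinearP. Qed.

Lemma bcompBl (R : realType) (U V W : normedModType R[i])
    (g g' : {blinear V -> W}) (f : {blinear U -> V}) :
  (g - g') \ob f = g \ob f - g' \ob f.
Proof. exact: blinearP. Qed.

Lemma lspan_image2P (K : pzRingType) (V : lmodType K) (I J : Type)
    (f : I -> J -> V) v :
  lspan [set f x y | x in [set: I] & y in [set: J]] v <->
  exists n (a : 'I_n -> K) (p : 'I_n -> I * J),
    v = \sum_(i < n) a i *: f (p i).1 (p i).2.
Proof.
split=> [[n [a [g [gS ->]]]]|[n [a [p ->]]]]; last first.
  exists n, a, (fun i => f (p i).1 (p i).2); split=> // i.
  by exists (p i).1 => //; exists (p i).2.
have /choice[p gp] : forall i, exists p : I * J, g i = f p.1 p.2.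
  by move=> i; have [x _ [y _ <-]] := gS i; exists (x, y).
by exists n, a, p; apply: eq_bigr => i _; rewrite gp.
Qed.

(** * Maps of X implemented by operators on H1 *)

Section Implementation.
Variables (R : realType) (H0 H1 : hilbertType R) (A : concreteCStar H0).
Variable X : opModule H1 A.
Implicit Types (x y z : X) (T : {blinear X -> X}) (S : {blinear H1 -> H1}).
Implicit Types (s : seq (X * H0)) (P Q : X -> X).

Lemma is_adjointP P Q : is_adjoint P Q <->
  forall x y, adj (opmod_val (P x)) \ob opmod_val y =
              adj (opmod_val x) \ob opmod_val (Q y).
Proof.
split=> PQ x y; first by have /(congr1 val) := PQ x y.
by apply: val_inj; exact: PQ.
Qed.

Lemma is_adjoint_sym P Q : is_adjoint P Q -> is_adjoint Q P.
Proof.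
move=> /is_adjointP PQ; apply/is_adjointP => x y.
by rewrite -[LHS]adjK adj_bcomp adjK -PQ adj_bcomp adjK.
Qed.

(** The C*-identity in the module: ||T' y||^2 = || <T T' y, y> ||, which is at
    most ||T|| ||T' y|| ||y||. *)
Lemma opnorm_is_adjoint T T' :
  is_adjoint T T' -> opnorm T' <= opnorm T.
Proof.
move=> /is_adjointP TT'; apply: opnorm_le => [|y]; first exact: opnorm_ge0.
rewrite -!rnormE -real_complexM lecR.
have [->|y0] := eqVneq (rnorm (T' y)) 0.
  by rewrite mulr_ge0 ?opnorm_ge0 ?rnorm_ge0.
have ygt0 : 0 < rnorm (T' y) by rewrite lt_def y0 rnorm_ge0.
have sq := opnorm_sqr_le (opmod_val (T' y)); rewrite -TT' in sq.
rewrite -(ler_pM2l ygt0) -expr2 (le_trans sq)//.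
rewrite (le_trans (opnorm_bcomp _ _))// mulrA ler_wpM2r ?opnorm_ge0//.
by rewrite (le_trans (opnorm_adj_le _))// mulrC; exact: (rnorm_blinear T).
Qed.

(** A list of pairs stands for an element of the algebraic tensor product of X
    and H0, which [ev id] maps onto the span of X H0. *)
Definition ev P s : H1 := \sum_(p <- s) opmod_val (P p.1) p.2.

Lemma inner_ev_adjoint P Q P' Q' s s' : is_adjoint P' Q' ->
  inner (ev (P' \o P) s) (ev Q s') = inner (ev P s) (ev (Q' \o Q) s').
Proof.
move=> /is_adjointP PQ; rewrite /ev !linear_sumlz /=.
apply: eq_bigr => p _; rewrite !linear_sumr /=.
apply: eq_bigr => q _; rewrite !adjP.
by have /(congr1 (fun f : {blinear H0 -> H0} => f q.2)) /= -> :=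
  PQ (P p.1) (Q q.1).
Qed.

(** The estimate that turns an adjointable map of X into an operator on H1.
    With P = T' T self-adjoint, the norms c_n of the vectors attached to P^n
    satisfy the doubling inequality, whence c_1 <= ||T||^2 c_0. *)
Lemma ev_le T T' s : is_adjoint T T' ->
  rnorm (ev T s) <= opnorm T * rnorm (ev id s).
Proof.
move=> TT'; pose P := T' \o T; pose N := opnorm T ^+ 2.
have N0 : 0 <= N by rewrite sqr_ge0.
have PP : is_adjoint P P.
  by move=> x y; rewrite (is_adjoint_sym TT') TT'.
have PnPn n : is_adjoint (iter n P) (iter n P).
  by elim: n => [|n IH] x y //; rewrite [iter n.+1 P x]iterSr IH PP.
pose c n := rnorm (ev (iter n P) s).
have c0 n : 0 <= c n by exact: rnorm_ge0.
have iterP_le n x : rnorm (iter n P x) <= N ^+ n * rnorm x.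
  elim: n => [|n IH]; first by rewrite mul1r.
  rewrite exprS -mulrA; apply: le_trans (ler_wpM2l N0 IH).
  rewrite iterS (le_trans (rnorm_blinear _ _))// /N expr2 -mulrA.
  by apply: ler_pM; rewrite ?opnorm_ge0 ?rnorm_ge0 ?(opnorm_is_adjoint TT')//
    rnorm_blinear.
have c1_le : c 1%N <= N * c 0%N.
  apply: (@le_of_doubling _ c (\sum_(p <- s) rnorm p.1 * rnorm p.2)) => // n.
    rewrite -inner_self_norm (@inner_ev_adjoint id (iter n P) _ _ s s (PnPn n)).
    rewrite mulrC (le_trans (Re_inner_le _ _))// ler_wpM2l ?rnorm_ge0//.
    rewrite /c -addnn.
    rewrite le_eqVlt; apply/orP; left; apply/eqP; congr (rnorm _).
    by apply: eq_bigr => p _; rewrite iterD.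
  rewrite /c /ev mulr_suml; elim/big_ind2: _ => [|u a v b ua vb|p _].
  - by rewrite /rnorm normr0.
  - by rewrite (le_trans (rnormD _ _))// lerD.
  - rewrite (le_trans (rnorm_blinear _ _))// mulrAC ler_wpM2r ?rnorm_ge0//.
    by rewrite mulrC; exact: iterP_le.
rewrite -ler_sqr ?nnegrE ?mulr_ge0 ?opnorm_ge0 ?rnorm_ge0//.
rewrite -inner_self_norm (@inner_ev_adjoint id _ _ _ s s TT').
rewrite (le_trans (Re_inner_le _ _))// exprMn -/N.
by rewrite [rnorm _ ^+ 2]expr2 mulrA mulrC ler_wpM2r ?rnorm_ge0.
Qed.

Definition implements S T : Prop :=
  forall x, opmod_val (T x) = S \ob opmod_val x.

Lemma implementsP a S T S' T' : implements S T -> implements S' T' ->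
  implements (a *: S + S') (a *: T + T').
Proof. by move=> ST ST' x; rewrite /= ST ST'; exact: blinearP. Qed.

Lemma implementsB S T S' T' : implements S T -> implements S' T' ->
  implements (S - S') (T - T').
Proof.
move=> ST ST'; have := implementsP (-1) ST' ST.
by rewrite !scaleN1r ![- _ + _]addrC.
Qed.

Lemma implements_bcomp S T S' T' : implements S T -> implements S' T' ->
  implements (S \ob S') (T \ob T').
Proof. by move=> ST ST' x; rewrite /= ST ST' bcompA. Qed.

Lemma implements_inj S T T' : implements S T -> implements S T' -> T = T'.
Proof.
by move=> ST ST'; apply: blinearP => x; apply: val_inj; rewrite /= ST ST'.
Qed.

Lemma opnorm_implements S T : implements S T -> opnorm T <= opnorm S.
Proof.
move=> ST; apply: opnorm_le => [|x]; first exact: opnorm_ge0.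
by rewrite /Num.norm /= ST -real_complexM lecR opnorm_bcomp.
Qed.

Lemma implements_theta x y :
  implements ((x : {blinear H0 -> H1}) \ob adj y) (theta x y).
Proof. by move=> z; rewrite /= bcompA. Qed.

Lemma implements_adjoint S T S' T' : implements S T -> implements S' T' ->
  adj S = S' -> is_adjoint T T'.
Proof.
move=> ST ST' SS'; apply/is_adjointP => x y.
by rewrite ST ST' -SS' adj_bcomp bcompA.
Qed.

Lemma is_adjointB T1 T2 P Q : is_adjoint T1 P -> is_adjoint T2 Q ->
  is_adjoint (T1 - T2) (P - Q).
Proof.
move=> /is_adjointP A1 /is_adjointP A2; apply/is_adjointP => x y /=.
rewrite adjB bcompBl A1 A2; apply: blinearP => xi /=.
by rewrite linearB.
Qed.

Hypothesis XH0_dense :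
  dense (lspan [set (x : X) xi | x in [set: X] & xi in [set: H0]]).

Lemma ev_dense (v : H1) (e : R) : 0 < e -> exists s, rnorm (v - ev id s) < e.
Proof.
move=> e0; have := XH0_dense.
move=> /(_ (ball v e%:C)^°)[||w [/interior_subset vw]].
- by exists v; apply: nbhsx_ballx; rewrite -[0]/(0%:C) ltcR.
- exact: open_interior.
move=> /lspan_image2P[n [a [p wE]]].
exists [seq ((p i).1, a i *: (p i).2) | i <- index_enum 'I_n].
rewrite -ltcR rnormE; move: vw; rewrite -ball_normE /= wE /ev big_map /=.
congr (`|_ - _| < _); apply: eq_bigr => i _ /=.
by rewrite linearZ.
Qed.

Lemma orthogonal_eq0 (v : H1) :
  (forall x xi, inner (opmod_val x xi) v = 0) -> v = 0.
Proof.
move=> v_orth; apply: rnorm_eq0; rewrite leNgt; apply/negP => v0.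
have [s vs] := ev_dense v v0.
have ev0 : inner (ev id s) v = 0.
  by rewrite /ev linear_sumlz big1 // => p _ /=; exact: v_orth.
have := Re_inner_le (v - ev id s) v.
rewrite linearBl /= ev0 subr0 inner_self_norm leNgt expr2.
by rewrite -/(rnorm _) -/(rnorm _) ltr_pM2r// vs.
Qed.

Lemma blinear_eq0_dense S : (forall x, S \ob opmod_val x = 0) -> S = 0.
Proof.
move=> SX0; rewrite -[S]adjK.
have -> : adj S = 0.
  apply: blinearP => v; apply: orthogonal_eq0 => x xi; rewrite -adjP.
  have /(congr1 (fun f : {blinear H0 -> H1} => f xi)) /= -> := SX0 x.
  by rewrite linear0l.
by apply: adj_unique => xi eta /=; rewrite linear0l linear0r.
Qed.

Lemma implements_unique S S' T : implements S T -> implements S' T -> S = S'.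
Proof.
move=> ST S'T; apply/eqP; rewrite -subr_eq0; apply/eqP.
by apply: blinear_eq0_dense => x; rewrite bcompBl -ST -S'T subrr.
Qed.

(** On X H0 the implementing operator is forced, and [ev_le] says that it is
    well defined and bounded there by the norm of T. *)
Lemma adjointable_implemented T : adjointable X T ->
  exists2 S, implements S T & opnorm S <= opnorm T.
Proof.
move=> adT; have TT' := madjP adT.
pose G (v w : H1) := exists2 s, v = ev id s & w = ev T s.
have [|||v e e0|S GS Sle] := @extend_dense_graph R H1 H1 G (opnorm T).
- exact: opnorm_ge0.
- move=> a _ _ _ _ [s -> ->] [s' -> ->].
  exists ([seq (p.1, a *: p.2) | p <- s] ++ s'); rewrite /ev big_cat big_map /=;
    congr (_ + _); rewrite scaler_sumr; apply: eq_bigr => p _ /=;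
    by rewrite linearZ.
- by move=> _ _ [s -> ->]; exact: ev_le TT'.
- have [s es] := ev_dense v e0.
  by exists (ev id s), (ev T s); split => //; exists s.
- exists S => // x; apply: blinearP => xi /=; apply/esym/GS.
  by exists [:: (x, xi)]; rewrite /ev big_seq1.
Qed.

Lemma opnorm_implemented S T : adjointable X T -> implements S T ->
  opnorm S <= opnorm T.
Proof.
by move=> /adjointable_implemented[S' S'T Sle] /implements_unique/(_ S'T)->.
Qed.

(** Both sides have the same inner products with the vectors y eta, which are
    total in H1. *)
Lemma implements_adj S T T' : implements S T -> is_adjoint T T' ->
  implements (adj S) T'.
Proof.
move=> ST /is_adjointP TT' x; apply: blinearP => xi.
apply/eqP; rewrite -subr_eq0; apply/eqP; apply: orthogonal_eq0 => y eta.
rewrite linearBr /= -[X in _ - X]adjP; apply/eqP; rewrite subr_eq0; apply/eqP.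
rewrite adjP.
have /(congr1 (fun f : {blinear H0 -> H0} => f xi)) /= <- := TT' y x.
by rewrite -adjP ST.
Qed.

(** * The closed span of the operators x y^* *)

Definition rank_ones := [set (x : {blinear H0 -> H1}) \ob adj y
  | x in [set: X] & y in [set: X]].

Lemma implements_sum n (a : 'I_n -> R[i]) (p : 'I_n -> X * X) :
  implements
    (\sum_i a i *: (((p i).1 : {blinear H0 -> H1}) \ob adj (p i).2))
    (\sum_i a i *: theta (p i).1 (p i).2).
Proof.
apply: (big_ind2 (fun S T => implements S T)) => [x|S T S' T' ST ST'|i _].
- exact: blinearP.
- by have := implementsP 1 ST ST'; rewrite !scale1r.
- rewrite -[X in implements X]addr0 -[X in implements _ X]addr0.
  apply: implementsP; first exact: implements_theta.
  by move=> x; exact: blinearP.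
Qed.

Lemma adj_sum (K K' : hilbertType R) n (f : 'I_n -> {blinear K -> K'}) :
  adj (\sum_i f i) = \sum_i adj (f i).
Proof.
apply: (big_morph adj) => [f1 f2|].
  by have := adj_semilinear 1 f1 f2; rewrite rmorph1 !scale1r.
by have := @adjB _ _ _ (0 : {blinear K -> K'}) 0; rewrite !subrr.
Qed.

Lemma closure_rank_ones_adj S :
  closure (lspan rank_ones) S -> closure (lspan rank_ones) (adj S).
Proof.
move=> /closure_rnormP CS; apply/closure_rnormP => e /CS[S' /lspan_image2P].
move=> [n [a [p S'E]]] SS'; exists (adj S'); last first.
  by apply: le_lt_trans SS'; rewrite -adjB; exact: opnorm_adj_le.
apply/lspan_image2P.
exists n, (fun i => Num.conj (a i)), (fun i => ((p i).2, (p i).1)).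
rewrite S'E adj_sum; apply: eq_bigr => i _ /=.
have := adj_semilinear (a i) (opmod_val (p i).1 \ob adj (p i).2) 0.
rewrite addr0 => ->; rewrite adj_bcomp adjK.
rewrite -[RHS]addr0; congr (_ + _).
by have := @adjB _ _ _ (0 : {blinear H1 -> H1}) 0; rewrite !subrr.
Qed.

(** For S = x y^* and z in X one has S z = x (y^* z), which is in X A; the
    general case follows as X is closed. *)
Lemma closure_rank_ones_preserve S x :
  closure (lspan rank_ones) S -> opmod_set X (S \ob opmod_val x).
Proof.
move=> /closure_rnormP CS; apply: opmod_closed; apply/closure_rnormP => e e0.
have k0 : 0 < rnorm x + 1 by rewrite ltr_wpDl ?rnorm_ge0.
have [|S' /lspan_image2P[n [a [p S'E]]] SS'] := CS (e / (rnorm x + 1)).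
  by rewrite divr_gt0.
exists (S' \ob opmod_val x).
  by rewrite S'E -implements_sum; exact: set_mem (valP _).
rewrite -bcompBl (le_lt_trans (opnorm_bcomp _ _))//.
rewrite ltr_pdivlMr// in SS'; apply: le_lt_trans SS'.
by rewrite ler_wpM2l ?opnorm_ge0// lerDl.
Qed.

(** Both S and its adjoint map X into X, so the restriction of S has the
    restriction of S^* as an adjoint. *)
Lemma closure_rank_ones_implements S : closure (lspan rank_ones) S ->
  exists2 T, adjointable X T & implements S T.
Proof.
have ex S1 : closure (lspan rank_ones) S1 -> exists T, implements S1 T.
  move=> CS; pose f x : X :=
    OpModElt (mem_set (closure_rank_ones_preserve x CS)).
  have fbl : f \in @blinear_pred R X X.
    apply/asboolP; split=> [a u v|]; first exact/val_inj/bcompP.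
    by exists (opnorm S1) => x; exact: bcomp_norm.
  by exists (BLinear fbl).
move=> CS; have [T ST] := ex _ CS.
have [T' ST'] := ex _ (closure_rank_ones_adj CS).
by exists T => //; exists T'; exact: implements_adjoint ST ST' erefl.
Qed.

(** The implementing operators of T and of an approximation T' by combinations
    of the theta_{x,y} are as close as T and T', by [opnorm_implemented]. *)
Lemma compacts_implemented T : compacts X T ->
  exists2 S, closure (lspan rank_ones) S & implements S T.
Proof.
move=> [adT /closure_rnormP CT]; have [S ST _] := adjointable_implemented adT.
exists S => //; apply/closure_rnormP => e /CT[T' /lspan_image2P[n [a [p T'E]]]].
move=> TT'; have ST' := implements_sum a p; rewrite -T'E in ST'.
set S' := (X in implements X T') in ST'.
have S'span : lspan rank_ones S' by apply/lspan_image2P; exists n, a, p.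
exists S' => //; apply: le_lt_trans TT'.
apply: opnorm_implemented (implementsB ST ST').
(* Comparing norms needs T - T' adjointable, and T' is because its
   implementing operator S' lies in the span of the x y^*. *)
have [T'' adT''] :=
  closure_rank_ones_implements (subset_closure S'span).
move=> /(implements_inj ST') T'T''; rewrite -T'T'' in adT''.
have [[T1 adT1] [T2 adT2]] := (adT, adT'').
by exists (T1 \- T2); exact: is_adjointB.
Qed.

(** The converse of [compacts_implemented], where the approximation is carried
    from H1 to X by [opnorm_implements]. *)
Lemma closure_rank_ones_compact S : closure (lspan rank_ones) S ->
  exists2 T, compacts X T & implements S T.
Proof.
move=> CS; have [T adT ST] := closure_rank_ones_implements CS.
exists T => //; split => //; move: CS => /closure_rnormP CS.
apply/closure_rnormP => e /CS[S' /lspan_image2P[n [a [p S'E]]] SS'].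
exists (\sum_i a i *: theta (p i).1 (p i).2).
  by apply/lspan_image2P; exists n, a, p.
apply: le_lt_trans SS'; apply: opnorm_implements.
by rewrite S'E; exact: implementsB ST (implements_sum a p).
Qed.

End Implementation.

(** * The isomorphism *)

Theorem proposition2p4 (R : realType) (H0 H1 : hilbertType R)
    (A : concreteCStar H0) (X : opModule H1 A)
    (XH0_dense :
      dense (lspan [set (x : X) xi | x in [set: X] & xi in [set: H0]])) :
  exists phi : {blinear X -> X} -> {blinear H1 -> H1},
    star_isomorphism bcomp madj bcomp adj (compacts X)
      (closure (lspan [set (x : {blinear H0 -> H1}) \ob adj y
                         | x in [set: X] & y in [set: X]]))
      phi /\
    forall x y : X, phi (theta x y) = (x : {blinear H0 -> H1}) \ob adj y.
Proof.
(* The default value 0 can only be reached outside the adjointable maps. *)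
pose phi (T : {blinear X -> X}) := xget 0 [set S | implements S T].
have phiP S (T : {blinear X -> X}) : implements S T -> phi T = S.
  rewrite /phi => ST; case: xgetP => [S' _ S'T|/(_ S)//].
  exact: implements_unique S'T ST.
have implements_phi T : adjointable X T -> implements (phi T) T.
  by move=> /(adjointable_implemented XH0_dense)[S ST _]; rewrite (phiP S T ST).
exists phi; split; last by move=> x y; exact/phiP/implements_theta.
split; first split.
- move=> T /(compacts_implemented XH0_dense)[S CS ST].
  by rewrite /= (phiP S T ST).
- move=> T T' /set_mem[adT _] /set_mem[adT' _] phiTT'.
  apply: implements_inj (implements_phi T adT) _; rewrite phiTT'.
  exact: implements_phi.
- by move=> S /closure_rank_ones_compact[T KT ST]; exists T => //; exact: phiP.
- move=> a T T' /set_mem[adT _] /set_mem[adT' _]; apply: phiP.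
  by apply: implementsP; exact: implements_phi.
- move=> T T' /set_mem[adT _] /set_mem[adT' _]; apply: phiP.
  by apply: implements_bcomp; exact: implements_phi.
- move=> T /set_mem[adT _]; apply: phiP.
  exact: implements_adj (implements_phi T adT) (madjP adT).
Qed.
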